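(* Let $H:\mathbb{A}\to\mathbb{A}$ be an endofunctor carrying a monad structure $\underline H=(H,m_H,e_H)$ and a comonad structure $\overline H=(H,\delta_H,\varepsilon_H)$, with a right adjoint $R$ carrying the induced (mate) monad structure $\underline R=(R,m_R,e_R)$ and comonad structure $\overline R=(R,\delta_R,\varepsilon_R)$. Let $\tau_H:HH\to HH$ be a natural transformation with mate $\tau_R:RR\to RR$. If $\mathbf{H}=(\underline H,\overline H)$ is a $\tau_H$-bimonad with double entwining $\tau_H$, then $\mathbf{R}=(\underline R,\overline R)$ is a $\tau_R$-bimonad with double entwining $\tau_R$. Moreover, $\tau_H$ satisfies the Yang–Baxter equation if and only if $\tau_R$ does.
   Context: Composition of functors is written by juxtaposition, $\cdot$ is vertical composition, whiskering is written $B\alpha,\alpha B$, and $\alpha\beta$ is the horizontal composite. Mates: if $H\dashv R$, then $H^n\dashv R^n$ for all $n\ge0$. With unit $\eta^{(n)}$ and counit $\sigma^{(n)}$, the mate of $\alpha:H^p\to H^q$ is $R^q\xrightarrow{\eta^{(p)}R^q}R^pH^pR^q\xrightarrow{R^p\alpha R^q}R^pH^qR^q\xrightarrow{R^p\sigma^{(q)}}R^p$. The structure maps $m_R,e_R,\delta_R,\varepsilon_R$ are the mates of $\delta_H,\varepsilon_H,m_H,e_H$, respectively. For an endofunctor $B$ with monad structure $(m,e)$ and comonad structure $(\delta,\varepsilon)$, a double entwining is a natural transformation $\tau:BB\to BB$ with $\tau\cdot eB=Be$, $\varepsilon B\cdot\tau=B\varepsilon$, $\delta B\cdot\tau=B\tau\cdot\tau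 B\cdot B\delta$, $\tau\cdot mB=Bm\cdot\tau B\cdot B\tau$, $\tau\cdot Be=eB$, $B\varepsilon\cdot\tau=\varepsilon B$, $B\delta\cdot\tau=\tau B\cdot B\tau\cdot\delta B$, $\tau\cdot Bm=mB\cdot B\tau\cdot\tau B$. $B$ is a $\tau$-bimonad if $\tau$ is a double entwining and $\delta\cdot m=mm\cdot B\tau B\cdot\delta\delta$, $\varepsilon\cdot m=\varepsilon\cdot B\varepsilon$, $\delta\cdot e=eB\cdot e$, $\varepsilon\cdot e=1$. $\tau$ satisfies the Yang–Baxter equation if $\tau B\cdot B\tau\cdot\tau B=B\tau\cdot\tau B\cdot B\tau$. *)

(* Defs.v *)
From Stdlib Require Import FunctionalExtensionality ProofIrrelevance.

Set Implicit Arguments.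
Unset Strict Implicit.
Set Primitive Projections.

Record Category := {
  Ob :> Type;
  Hom : Ob -> Ob -> Type;
  ident : forall x, Hom x x;
  compose : forall x y z, Hom y z -> Hom x y -> Hom x z;
  compose_assoc : forall x y z w (h : Hom z w) (g : Hom y z) (f : Hom x y),
    compose h (compose g f) = compose (compose h g) f;
  ident_l : forall x y (f : Hom x y), compose (ident y) f = f;
  ident_r : forall x y (f : Hom x y), compose f (ident x) = f }.

Arguments ident {_} _.

(* The functor laws are stated relative to an equation (instead of as
   [fmap (ident x) = ident (fob x)] and
   [fmap (compose g f) = compose (fmap g) (fmap f)], which are derived below as
   [fmap_ident] and [fmap_compose]) so that, with primitive projections,
   composition of functors is associative and unital up to conversion.  Hence
   for instance B(BB), (BB)B and B(1B)B need no coercions between them. *)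
Record Functor (A B : Category) := {
  fob :> A -> B;
  fmap : forall x y, Hom x y -> Hom (fob x) (fob y);
  fmap_ident_law : forall x (f : Hom x x), f = ident x -> fmap f = ident (fob x);
  fmap_compose_law : forall x y z (g : Hom y z) (f : Hom x y) (h : Hom x z),
    h = compose g f -> fmap h = compose (fmap g) (fmap f) }.

Arguments fmap {A B} _ {x y} _.

Lemma fmap_ident A B (F : Functor A B) x : fmap F (ident x) = ident (F x).
Proof. exact (fmap_ident_law F eq_refl). Qed.

Lemma fmap_compose A B (F : Functor A B) x y z (g : Hom y z) (f : Hom x y) :
  fmap F (compose g f) = compose (fmap F g) (fmap F f).
Proof. exact (fmap_compose_law F eq_refl). Qed.

Definition functor_id (A : Category) : Functor A A :=
  {| fob := fun x => x;
     fmap := fun _ _ f => f;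
     fmap_ident_law := fun _ _ e => e;
     fmap_compose_law := fun _ _ _ _ _ _ e => e |}.

Definition functor_comp (A B C : Category) (F : Functor B C) (G : Functor A B) :
    Functor A C :=
  {| fob := fun x => F (G x);
     fmap := fun _ _ f => fmap F (fmap G f);
     fmap_ident_law := fun _ _ e => fmap_ident_law F (fmap_ident_law G e);
     fmap_compose_law := fun _ _ _ _ _ _ e =>
       fmap_compose_law F (fmap_compose_law G e) |}.

Declare Scope nat_trans_scope.
Delimit Scope nat_trans_scope with nt.
Open Scope nat_trans_scope.

Notation "'Id'" := (functor_id _) : nat_trans_scope.
Notation "F ∘ G" := (functor_comp F G)
  (at level 40, left associativity) : nat_trans_scope.

Record NatTrans (A B : Category) (F G : Functor A B) := {
  component :> forall x : A, Hom (F x) (G x);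
  naturality : forall x y (f : Hom x y),
    compose (component y) (fmap F f) = compose (fmap G f) (component x) }.

Notation "F ⇒ G" := (NatTrans F G) (at level 90) : nat_trans_scope.

Lemma nat_trans_ext A B (F G : Functor A B) (a b : F ⇒ G) :
  (forall x, a x = b x) -> a = b.
Proof.
  destruct a as [a na], b as [b nb]; simpl; intros e.
  assert (e' : a = b) by (apply functional_extensionality_dep; exact e).
  subst b; f_equal; apply proof_irrelevance.
Qed.

Lemma nt_id_nat A B (F : Functor A B) x y (f : Hom x y) :
  compose (ident (F y)) (fmap F f) = compose (fmap F f) (ident (F x)).
Proof. now rewrite ident_l, ident_r. Qed.

Definition nt_id A B (F : Functor A B) : F ⇒ F :=
  {| component := fun x => ident (F x); naturality := nt_id_nat F |}.

Lemma nt_comp_nat A B (F G K : Functor A B) (b : G ⇒ K) (a : F ⇒ G)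
    x y (f : Hom x y) :
  compose (compose (b y) (a y)) (fmap F f) =
  compose (fmap K f) (compose (b x) (a x)).
Proof.
  now rewrite <- compose_assoc, naturality, compose_assoc, naturality,
    compose_assoc.
Qed.

Definition nt_comp A B (F G K : Functor A B) (b : G ⇒ K) (a : F ⇒ G) : F ⇒ K :=
  {| component := fun x => compose (b x) (a x);
     naturality := nt_comp_nat b a |}.

Lemma whisker_l_nat A B C (F : Functor B C) (G K : Functor A B) (a : G ⇒ K)
    x y (f : Hom x y) :
  compose (fmap F (a y)) (fmap (F ∘ G) f) =
  compose (fmap (F ∘ K) f) (fmap F (a x)).
Proof. simpl; now rewrite <- !fmap_compose, naturality. Qed.

Definition whisker_l A B C (F : Functor B C) (G K : Functor A B) (a : G ⇒ K) :
    F ∘ G ⇒ F ∘ K :=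
  @Build_NatTrans A C (F ∘ G) (F ∘ K) (fun x => fmap F (a x)) (whisker_l_nat F a).

Definition whisker_r A B C (G K : Functor B C) (a : G ⇒ K) (F : Functor A B) :
    G ∘ F ⇒ K ∘ F :=
  @Build_NatTrans A C (G ∘ F) (K ∘ F) (fun x => a (F x))
    (fun _ _ f => naturality a (fmap F f)).

Notation "b · a" := (nt_comp b a)
  (at level 50, left associativity) : nat_trans_scope.
Notation "F ◁ a" := (whisker_l F a)
  (at level 42, right associativity) : nat_trans_scope.
Notation "a ▷ F" := (whisker_r a F)
  (at level 41, left associativity) : nat_trans_scope.

Definition horizontal A B C (F F' : Functor B C) (G G' : Functor A B)
    (a : F ⇒ F') (b : G ⇒ G') : F ∘ G ⇒ F' ∘ G' :=
  (a ▷ G') · (F ◁ b).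

Notation "a ⋆ b" := (horizontal a b)
  (at level 43, left associativity) : nat_trans_scope.

Record Adjunction (A B : Category) (L : Functor A B) (R : Functor B A) := {
  unit : Id ⇒ R ∘ L;
  counit : L ∘ R ⇒ Id;
  triangle_l : (counit ▷ L) · (L ◁ unit) = nt_id L;
  triangle_r : (R ◁ counit) · (unit ▷ R) = nt_id R }.

Notation "L ⊣ R" := (Adjunction L R) (at level 90) : nat_trans_scope.

Lemma adj_id_triangle_l A :
  (nt_id Id ▷ Id) · (Id ◁ nt_id Id) = nt_id (functor_id A).
Proof. apply nat_trans_ext; intro x; apply ident_l. Qed.

Lemma adj_id_triangle_r A :
  (Id ◁ nt_id Id) · (nt_id Id ▷ Id) = nt_id (functor_id A).
Proof. apply nat_trans_ext; intro x; apply ident_l. Qed.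

Definition adj_id A : functor_id A ⊣ functor_id A :=
  @Build_Adjunction A A Id Id (nt_id Id) (nt_id Id)
    (adj_id_triangle_l A) (adj_id_triangle_r A).

Section AdjComp.
Variables (A B C : Category) (L : Functor A B) (R : Functor B A)
  (L' : Functor B C) (R' : Functor C B) (a' : L' ⊣ R') (a : L ⊣ R).

Definition adj_comp_unit : Id ⇒ (R ∘ R') ∘ (L' ∘ L) :=
  (R ◁ unit a' ▷ L) · unit a.

Definition adj_comp_counit : (L' ∘ L) ∘ (R ∘ R') ⇒ Id :=
  counit a' · (L' ◁ counit a ▷ R').

Lemma adj_comp_triangle_l :
  (adj_comp_counit ▷ (L' ∘ L)) · ((L' ∘ L) ◁ adj_comp_unit) = nt_id (L' ∘ L).
Proof.
  apply nat_trans_ext; intro x; cbn.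
  assert (k : compose (counit a (R' (L' (L x))))
      (fmap L (compose (fmap R (unit a' (L x))) (unit a x))) = unit a' (L x)).
  { rewrite fmap_compose, compose_assoc.
    etransitivity; [apply (f_equal (fun g => compose g (fmap L (unit a x))));
      exact (naturality (counit a) (unit a' (L x))) |].
    rewrite <- compose_assoc.
    etransitivity; [apply f_equal;
      exact (f_equal (fun t : L ⇒ L => t x) (triangle_l a)) |].
    apply ident_r. }
  rewrite <- compose_assoc.
  etransitivity; [apply f_equal; symmetry; apply (fmap_compose L') |].
  etransitivity; [apply f_equal; apply f_equal; exact k |].
  exact (f_equal (fun t : L' ⇒ L' => t (L x)) (triangle_l a')).
Qed.

Lemma adj_comp_triangle_r :
  ((R ∘ R') ◁ adj_comp_counit) · (adj_comp_unit ▷ (R ∘ R')) = nt_id (R ∘ R').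
Proof.
  apply nat_trans_ext; intro x; cbn.
  assert (k : compose (fmap R' (compose (counit a' x)
      (fmap L' (counit a (R' x))))) (unit a' (L (R (R' x)))) = counit a (R' x)).
  { rewrite fmap_compose, <- compose_assoc.
    etransitivity; [apply f_equal; symmetry;
      exact (naturality (unit a') (counit a (R' x))) |].
    rewrite compose_assoc.
    etransitivity; [apply (f_equal (fun g => compose g (counit a (R' x))));
      exact (f_equal (fun t : R' ⇒ R' => t x) (triangle_r a')) |].
    apply ident_l. }
  rewrite compose_assoc.
  etransitivity; [apply (f_equal (fun g => compose g (unit a (R (R' x)))));
    symmetry; apply (fmap_compose R) |].
  etransitivity; [apply (f_equal (fun g => compose (fmap R g) _)); exact k |].
  exact (f_equal (fun t : R ⇒ R => t (R' x)) (triangle_r a)).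
Qed.

Definition adj_comp : L' ∘ L ⊣ R ∘ R' :=
  @Build_Adjunction A C (L' ∘ L) (R ∘ R') adj_comp_unit adj_comp_counit
    adj_comp_triangle_l adj_comp_triangle_r.
End AdjComp.

(* For an adjunction [a : H ⊣ R] with powers [adj_id A] : H^0 ⊣ R^0,
   [a] : H^1 ⊣ R^1 and [adj_comp a a] : H^2 ⊣ R^2, the mate of H^p ⇒ H^q is
   the case L = H^p, L' = H^q. *)
Definition mate A B (L L' : Functor A B) (R R' : Functor B A)
    (a : L ⊣ R) (a' : L' ⊣ R') (t : L ⇒ L') : R' ⇒ R :=
  (R ◁ counit a') · (R ◁ t ▷ R') · (unit a ▷ R').

Section Bimonads.
Variables (A : Category) (B : Functor A A).

Record is_monad (m : B ∘ B ⇒ B) (e : Id ⇒ B) : Prop := {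
  monad_assoc : m · (m ▷ B) = m · (B ◁ m);
  monad_unit_l : m · (e ▷ B) = nt_id B;
  monad_unit_r : m · (B ◁ e) = nt_id B }.

Record is_comonad (d : B ⇒ B ∘ B) (eps : B ⇒ Id) : Prop := {
  comonad_coassoc : (d ▷ B) · d = (B ◁ d) · d;
  comonad_counit_l : (eps ▷ B) · d = nt_id B;
  comonad_counit_r : (B ◁ eps) · d = nt_id B }.

Record is_double_entwining (m : B ∘ B ⇒ B) (e : Id ⇒ B)
    (d : B ⇒ B ∘ B) (eps : B ⇒ Id) (tau : B ∘ B ⇒ B ∘ B) : Prop := {
  entw_unit_l : tau · (e ▷ B) = B ◁ e;
  entw_counit_l : (eps ▷ B) · tau = B ◁ eps;
  entw_comult_l : (d ▷ B) · tau = (B ◁ tau) · (tau ▷ B) · (B ◁ d);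
  entw_mult_l : tau · (m ▷ B) = (B ◁ m) · (tau ▷ B) · (B ◁ tau);
  entw_unit_r : tau · (B ◁ e) = e ▷ B;
  entw_counit_r : (B ◁ eps) · tau = eps ▷ B;
  entw_comult_r : (B ◁ d) · tau = (tau ▷ B) · (B ◁ tau) · (d ▷ B);
  entw_mult_r : tau · (B ◁ m) = (m ▷ B) · (B ◁ tau) · (tau ▷ B) }.

Record is_bimonad (m : B ∘ B ⇒ B) (e : Id ⇒ B)
    (d : B ⇒ B ∘ B) (eps : B ⇒ Id) (tau : B ∘ B ⇒ B ∘ B) : Prop := {
  bimonad_monad : is_monad m e;
  bimonad_comonad : is_comonad d eps;
  bimonad_entwining : is_double_entwining m e d eps tau;
  bimonad_comult_mult : d · m = (m ⋆ m) · (B ◁ tau ▷ B) · (d ⋆ d);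
  bimonad_counit_mult : eps · m = eps · (B ◁ eps);
  bimonad_comult_unit : d · e = (e ▷ B) · e;
  bimonad_counit_unit : eps · e = nt_id Id }.

Definition yang_baxter (tau : B ∘ B ⇒ B ∘ B) : Prop :=
  (tau ▷ B) · (B ◁ tau) · (tau ▷ B) = (B ◁ tau) · (tau ▷ B) · (B ◁ tau).
End Bimonads.

(* Main.v *)
Require Import Defs.

Set Implicit Arguments.
Unset Strict Implicit.

(** Say that [s : R' ⇒ R] is conjugate to [t : L ⇒ L'] when both give the same
    map [L R' ⇒ Id] once the counits are applied.  Every [t] has exactly one
    conjugate, namely its mate, and every [s] is conjugate to at most one [t]
    ([conjugate_mate], [conjugate_unique], [conjugate_injective]).  Conjugation
    reverses vertical composition ([conjugate_comp]), and, because the right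
    adjoint of [M L] is [R S], it exchanges left with right whiskering
    ([conjugate_whisker_l], [conjugate_whisker_r]).

    So conjugation turns an equation between transformations of powers of [H]
    into the equation for [R] in which arrows and sides are both reversed, with
    [m], [e] exchanged for [d], [eps].  This symmetry permutes the axioms of a
    bimonad: it exchanges the monad laws with the comonad laws, each left
    entwining axiom with a right one of the dual structure map, and the
    compatibility of [eps] with [m] with that of [d] with [e]; it fixes the
    remaining axioms, and swaps the two sides of the Yang–Baxter equation.
    Injectivity of conjugation gives the converse for Yang–Baxter. *)

(** * Conjugate transformations *)

(** Stated on components, so that two descriptions of a transformation with the
    same components are interchangeable up to conversion here. *)
Definition conjugate A B (L L' : Functor A B) (R R' : Functor B A)
    (a : L ⊣ R) (a' : L' ⊣ R') (t : L ⇒ L') (s : R' ⇒ R) : Prop :=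
  forall y, @compose B (L (R' y)) (L' (R' y)) y (counit a' y) (t (R' y)) =
            @compose B (L (R' y)) (L (R y)) y (counit a y) (fmap L (s y)).

Lemma triangle_l_at A B (L : Functor A B) (R : Functor B A) (a : L ⊣ R) x :
  @compose B (L x) (L (R (L x))) (L x)
    (counit a (L x)) (@fmap A B L x (R (L x)) (unit a x)) = ident (L x).
Proof. exact (f_equal (fun t : L ⇒ L => t x) (triangle_l a)). Qed.

Lemma triangle_r_at A B (L : Functor A B) (R : Functor B A) (a : L ⊣ R) y :
  @compose A (R y) (R (L (R y))) (R y)
    (@fmap B A R (L (R y)) y (counit a y)) (unit a (R y)) = ident (R y).
Proof. exact (f_equal (fun t : R ⇒ R => t y) (triangle_r a)). Qed.

Lemma counit_natural A B (L : Functor A B) (R : Functor B A) (a : L ⊣ R)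
    x y (f : Hom x y) :
  @compose B (L (R x)) (L (R y)) y (counit a y) (fmap L (fmap R f)) =
  @compose B (L (R x)) x y f (counit a x).
Proof. exact (naturality (counit a) f). Qed.

Lemma unit_natural A B (L : Functor A B) (R : Functor B A) (a : L ⊣ R)
    x y (f : Hom x y) :
  @compose A x y (R (L y)) (unit a y) f =
  @compose A x (R (L x)) (R (L y)) (fmap R (fmap L f)) (unit a x).
Proof. exact (naturality (unit a) f). Qed.

Lemma conjugate_mate A B (L L' : Functor A B) (R R' : Functor B A)
    (a : L ⊣ R) (a' : L' ⊣ R') (t : L ⇒ L') :
  conjugate a a' t (mate a a' t).
Proof.
  intro y; cbn.
  rewrite <- (fmap_compose R), fmap_compose, compose_assoc, counit_natural.
  now rewrite <- compose_assoc, triangle_l_at, ident_r.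
Qed.

(** The triangle identity of [a] recovers [s] from the right-hand side of the
    conjugacy equation. *)
Lemma conjugate_unique A B (L L' : Functor A B) (R R' : Functor B A)
    (a : L ⊣ R) (a' : L' ⊣ R') (t t' : L ⇒ L') (s s' : R' ⇒ R) :
  t = t' -> conjugate a a' t s -> conjugate a a' t' s' -> s = s'.
Proof.
  assert (rec : forall r : R' ⇒ R, forall y,
    r y = @compose A (R' y) (R (L (R' y))) (R y)
            (fmap R (@compose B (L (R' y)) (L (R y)) y
                       (counit a y) (fmap L (r y))))
            (unit a (R' y))).
  { intros r y.
    rewrite fmap_compose, <- compose_assoc, <- unit_natural, compose_assoc.
    now rewrite triangle_r_at, ident_l. }
  intros <- cs cs'; apply nat_trans_ext; intro y.
  now rewrite (rec s), (rec s'), <- (cs y), <- (cs' y).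
Qed.

(** Dually, the triangle identity of [a'] recovers [t]. *)
Lemma conjugate_injective A B (L L' : Functor A B) (R R' : Functor B A)
    (a : L ⊣ R) (a' : L' ⊣ R') (t t' : L ⇒ L') (s s' : R' ⇒ R) :
  s = s' -> conjugate a a' t s -> conjugate a a' t' s' -> t = t'.
Proof.
  assert (rec : forall r : L ⇒ L', forall x,
    r x = @compose B (L x) (L (R' (L' x))) (L' x)
            (@compose B (L (R' (L' x))) (L' (R' (L' x))) (L' x)
               (counit a' (L' x)) (r (R' (L' x))))
            (@fmap A B L x (R' (L' x)) (unit a' x))).
  { intros r x.
    rewrite <- compose_assoc, (naturality r), compose_assoc.
    now rewrite triangle_l_at, ident_l. }
  intros <- ct ct'; apply nat_trans_ext; intro x.
  now rewrite (rec t), (rec t'), (ct (L' x)), (ct' (L' x)).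
Qed.

Lemma conjugate_id A B (L : Functor A B) (R : Functor B A) (a : L ⊣ R) :
  conjugate a a (nt_id L) (nt_id R).
Proof. intro y; cbn; now rewrite fmap_ident. Qed.

Lemma conjugate_comp A B (L L' L'' : Functor A B) (R R' R'' : Functor B A)
    (a : L ⊣ R) (a' : L' ⊣ R') (a'' : L'' ⊣ R'')
    (u : L' ⇒ L'') (t : L ⇒ L') (v : R'' ⇒ R') (s : R' ⇒ R) :
  conjugate a' a'' u v -> conjugate a a' t s ->
  conjugate a a'' (u · t) (s · v).
Proof.
  intros cu ct y; cbn.
  rewrite compose_assoc, cu, <- compose_assoc, <- (naturality t).
  now rewrite compose_assoc, ct, <- compose_assoc, fmap_compose.
Qed.

(** Reversing [(w · u) · t] produces the other bracketing of the three factors;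
    the conclusion is rebracketed to the left. *)
Lemma conjugate_comp3 A B (L L' L'' L3 : Functor A B)
    (R R' R'' R3 : Functor B A)
    (a : L ⊣ R) (a' : L' ⊣ R') (a'' : L'' ⊣ R'') (a3 : L3 ⊣ R3)
    (w : L'' ⇒ L3) (u : L' ⇒ L'') (t : L ⇒ L')
    (r : R3 ⇒ R'') (v : R'' ⇒ R') (s : R' ⇒ R) :
  conjugate a'' a3 w r -> conjugate a' a'' u v -> conjugate a a' t s ->
  conjugate a a3 (w · u · t) (s · v · r).
Proof.
  intros cw cu ct y.
  rewrite (conjugate_comp (conjugate_comp cw cu) ct y); cbn.
  now rewrite compose_assoc.
Qed.

(** * Composite adjunctions and whiskering *)

(** Powers of [H] carry several adjunctions, such as the two bracketings of a
    triple composite, which agree only propositionally.  Since conjugacy only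
    involves counits, it suffices to know that [c] has the counit of the
    composite of [b] and [a]. *)
Definition is_composite A B C (L : Functor A B) (R : Functor B A)
    (M : Functor B C) (S : Functor C B)
    (b : M ⊣ S) (a : L ⊣ R) (c : M ∘ L ⊣ R ∘ S) : Prop :=
  forall z, counit c z = @compose C (M (L (R (S z)))) (M (S z)) z
    (counit b z) (@fmap B C M (L (R (S z))) (S z) (counit a (S z))).

Lemma is_composite_adj_comp A B C (L : Functor A B) (R : Functor B A)
    (M : Functor B C) (S : Functor C B) (b : M ⊣ S) (a : L ⊣ R) :
  is_composite b a (adj_comp b a).
Proof. intro z; reflexivity. Qed.

Lemma is_composite_id_l A B (L : Functor A B) (R : Functor B A) (a : L ⊣ R) :
  is_composite (adj_id B) a a.
Proof. intro z; cbn; now rewrite ident_l. Qed.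

Lemma is_composite_id_r A B (L : Functor A B) (R : Functor B A) (a : L ⊣ R) :
  is_composite a (adj_id A) a.
Proof. intro z; cbn; now rewrite fmap_ident, ident_r. Qed.

Lemma is_composite_assoc A B C D (L : Functor A B) (R : Functor B A)
    (M : Functor B C) (S : Functor C B) (N : Functor C D) (T : Functor D C)
    (c : N ⊣ T) (b : M ⊣ S) (a : L ⊣ R)
    (ba : M ∘ L ⊣ R ∘ S) (cb : N ∘ M ⊣ S ∘ T)
    (cba : (N ∘ M) ∘ L ⊣ R ∘ (S ∘ T)) :
  is_composite b a ba -> is_composite c b cb -> is_composite c ba cba ->
  is_composite cb a cba.
Proof.
  intros hba hcb hcba z.
  rewrite (hcba z), (hcb z), (hba (T z)), fmap_compose.
  apply compose_assoc.
Qed.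

Lemma conjugate_whisker_l A B C (L L' : Functor A B) (R R' : Functor B A)
    (M : Functor B C) (S : Functor C B) (b : M ⊣ S) (a : L ⊣ R) (a' : L' ⊣ R')
    (c : M ∘ L ⊣ R ∘ S) (c' : M ∘ L' ⊣ R' ∘ S) (t : L ⇒ L') (s : R' ⇒ R) :
  is_composite b a c -> is_composite b a' c' ->
  conjugate a a' t s -> conjugate c c' (M ◁ t) (s ▷ S).
Proof.
  intros hc hc' ct z; rewrite (hc z), (hc' z); cbn.
  now rewrite <- !compose_assoc, <- !fmap_compose, ct.
Qed.

Lemma conjugate_whisker_r A B C (L : Functor A B) (R : Functor B A)
    (M M' : Functor B C) (S S' : Functor C B)
    (b : M ⊣ S) (b' : M' ⊣ S') (a : L ⊣ R)
    (c : M ∘ L ⊣ R ∘ S) (c' : M' ∘ L ⊣ R ∘ S') (u : M ⇒ M') (v : S' ⇒ S) :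
  is_composite b a c -> is_composite b' a c' ->
  conjugate b b' u v -> conjugate c c' (u ▷ L) (R ◁ v).
Proof.
  intros hc hc' cu z; rewrite (hc z), (hc' z); cbn.
  rewrite <- compose_assoc, <- (naturality u), compose_assoc, cu.
  now rewrite <- !compose_assoc, <- !fmap_compose, counit_natural.
Qed.

(** * Bimonads and the Yang–Baxter equation on the right adjoint *)

Section Powers.
Variables (A : Category) (H R : Functor A A) (adj : H ⊣ R).

Let a0 : Id ⊣ Id := adj_id A.
Let a2 : H ∘ H ⊣ R ∘ R := adj_comp adj adj.
Let a3 : H ∘ (H ∘ H) ⊣ (R ∘ R) ∘ R := adj_comp adj a2.
Let a4 : H ∘ (H ∘ (H ∘ H)) ⊣ ((R ∘ R) ∘ R) ∘ R := adj_comp adj a3.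

(* [kpq] splits the chosen adjunction on [H^(p+q)] as [H^p] after [H^q]. *)
Let k01 : is_composite a0 adj adj := is_composite_id_l adj.
Let k10 : is_composite adj a0 adj := is_composite_id_r adj.
Let k11 : is_composite adj adj a2 := is_composite_adj_comp adj adj.
Let k12 : is_composite adj a2 a3 := is_composite_adj_comp adj a2.
Let k13 : is_composite adj a3 a4 := is_composite_adj_comp adj a3.
Let k21 : is_composite a2 adj a3 := is_composite_assoc k11 k11 k12.
Let k22 : is_composite a2 a2 a4 := is_composite_assoc k12 k11 k13.

Variables (m_H : H ∘ H ⇒ H) (e_H : Id ⇒ H) (d_H : H ⇒ H ∘ H) (eps_H : H ⇒ Id)
  (m_R : R ∘ R ⇒ R) (e_R : Id ⇒ R) (d_R : R ⇒ R ∘ R) (eps_R : R ⇒ Id)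
  (tau_H : H ∘ H ⇒ H ∘ H) (tau_R : R ∘ R ⇒ R ∘ R).

Hypotheses (cd : conjugate adj a2 d_H m_R) (ceps : conjugate adj a0 eps_H e_R)
  (cm : conjugate a2 adj m_H d_R) (ce : conjugate a0 adj e_H eps_R)
  (ctau : conjugate a2 a2 tau_H tau_R).

Let mH : conjugate a3 a2 (m_H ▷ H) (R ◁ d_R) := conjugate_whisker_r k21 k11 cm.
Let Hm : conjugate a3 a2 (H ◁ m_H) (d_R ▷ R) := conjugate_whisker_l k12 k11 cm.
Let eH : conjugate adj a2 (e_H ▷ H) (R ◁ eps_R) :=
  conjugate_whisker_r k01 k11 ce.
Let He : conjugate adj a2 (H ◁ e_H) (eps_R ▷ R) :=
  conjugate_whisker_l k10 k11 ce.
Let dH : conjugate a2 a3 (d_H ▷ H) (R ◁ m_R) := conjugate_whisker_r k11 k21 cd.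
Let Hd : conjugate a2 a3 (H ◁ d_H) (m_R ▷ R) := conjugate_whisker_l k11 k12 cd.
Let epsH : conjugate a2 adj (eps_H ▷ H) (R ◁ e_R) :=
  conjugate_whisker_r k11 k01 ceps.
Let Heps : conjugate a2 adj (H ◁ eps_H) (e_R ▷ R) :=
  conjugate_whisker_l k11 k10 ceps.
Let tauH : conjugate a3 a3 (tau_H ▷ H) (R ◁ tau_R) :=
  conjugate_whisker_r k21 k21 ctau.
Let Htau : conjugate a3 a3 (H ◁ tau_H) (tau_R ▷ R) :=
  conjugate_whisker_l k12 k12 ctau.
(* The whiskering lemmas give [(R ◁ tau_R) ▷ R], which has the same components
   as the transformation written here. *)
Let HtauH : conjugate a4 a4 (H ◁ tau_H ▷ H) (R ◁ tau_R ▷ R) :=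
  conjugate_whisker_l k13 k13 tauH.
Let mm : conjugate a4 a2 (m_H ⋆ m_H) (d_R ⋆ d_R) :=
  conjugate_comp mH (conjugate_whisker_l k22 k21 cm).
Let dd : conjugate a2 a4 (d_H ⋆ d_H) (m_R ⋆ m_R) :=
  conjugate_comp (conjugate_whisker_r k12 k22 cd) Hd.

Lemma conjugate_is_monad : is_comonad d_H eps_H -> is_monad m_R e_R.
Proof.
  intros [coassoc counit_l counit_r]; constructor.
  - exact (conjugate_unique (eq_sym coassoc)
             (conjugate_comp Hd cd) (conjugate_comp dH cd)).
  - exact (conjugate_unique counit_r
             (conjugate_comp Heps cd) (conjugate_id adj)).
  - exact (conjugate_unique counit_l
             (conjugate_comp epsH cd) (conjugate_id adj)).
Qed.

Lemma conjugate_is_comonad : is_monad m_H e_H -> is_comonad d_R eps_R.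
Proof.
  intros [assoc unit_l unit_r]; constructor.
  - exact (conjugate_unique (eq_sym assoc)
             (conjugate_comp cm Hm) (conjugate_comp cm mH)).
  - exact (conjugate_unique unit_r
             (conjugate_comp cm He) (conjugate_id adj)).
  - exact (conjugate_unique unit_l
             (conjugate_comp cm eH) (conjugate_id adj)).
Qed.

(** Conjugation sends the axiom for [Bα] to the axiom for [βB], where [β] is
    conjugate to [α], so the right axioms of [tau_H] yield the left ones of
    [tau_R], and conversely. *)
Lemma conjugate_is_double_entwining :
  is_double_entwining m_H e_H d_H eps_H tau_H ->
  is_double_entwining m_R e_R d_R eps_R tau_R.
Proof.
  intros h; constructor.
  - exact (conjugate_unique (entw_counit_r h) (conjugate_comp Heps ctau) epsH).
  - exact (conjugate_unique (entw_unit_r h) (conjugate_comp ctau He) eH).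
  - exact (conjugate_unique (entw_mult_r h)
             (conjugate_comp ctau Hm) (conjugate_comp3 mH Htau tauH)).
  - exact (conjugate_unique (entw_comult_r h)
             (conjugate_comp Hd ctau) (conjugate_comp3 tauH Htau dH)).
  - exact (conjugate_unique (entw_counit_l h) (conjugate_comp epsH ctau) Heps).
  - exact (conjugate_unique (entw_unit_l h) (conjugate_comp ctau eH) He).
  - exact (conjugate_unique (entw_mult_l h)
             (conjugate_comp ctau mH) (conjugate_comp3 Hm tauH Htau)).
  - exact (conjugate_unique (entw_comult_l h)
             (conjugate_comp dH ctau) (conjugate_comp3 Htau tauH Hd)).
Qed.

Lemma conjugate_is_bimonad :
  is_bimonad m_H e_H d_H eps_H tau_H -> is_bimonad m_R e_R d_R eps_R tau_R.
Proof.
  intros h; constructor.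
  - exact (conjugate_is_monad (bimonad_comonad h)).
  - exact (conjugate_is_comonad (bimonad_monad h)).
  - exact (conjugate_is_double_entwining (bimonad_entwining h)).
  - exact (conjugate_unique (bimonad_comult_mult h)
             (conjugate_comp cd cm) (conjugate_comp3 mm HtauH dd)).
  - exact (conjugate_unique (bimonad_comult_unit h)
             (conjugate_comp cd ce) (conjugate_comp eH ce)).
  - exact (conjugate_unique (bimonad_counit_mult h)
             (conjugate_comp ceps cm) (conjugate_comp ceps Heps)).
  - exact (conjugate_unique (bimonad_counit_unit h)
             (conjugate_comp ceps ce) (conjugate_id a0)).
Qed.

(** The two sides for [H] have the opposite sides for [R] as conjugates. *)
Lemma conjugate_yang_baxter : yang_baxter tau_H <-> yang_baxter tau_R.
Proof.
  pose proof (conjugate_comp3 tauH Htau tauH) as l.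
  pose proof (conjugate_comp3 Htau tauH Htau) as r.
  split; intro yb.
  - exact (conjugate_unique (eq_sym yb) r l).
  - exact (conjugate_injective (eq_sym yb) l r).
Qed.
End Powers.

Theorem mainTheorem9 (A : Category) (H R : Functor A A) (adj : H ⊣ R)
    (m_H : H ∘ H ⇒ H) (e_H : Id ⇒ H) (d_H : H ⇒ H ∘ H) (eps_H : H ⇒ Id)
    (m_R : R ∘ R ⇒ R) (e_R : Id ⇒ R) (d_R : R ⇒ R ∘ R) (eps_R : R ⇒ Id)
    (tau_H : H ∘ H ⇒ H ∘ H) (tau_R : R ∘ R ⇒ R ∘ R) :
  is_monad m_H e_H ->
  is_comonad d_H eps_H ->
  m_R = mate adj (adj_comp adj adj) d_H ->
  e_R = mate adj (adj_id A) eps_H ->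
  d_R = mate (adj_comp adj adj) adj m_H ->
  eps_R = mate (adj_id A) adj e_H ->
  tau_R = mate (adj_comp adj adj) (adj_comp adj adj) tau_H ->
  (is_bimonad m_H e_H d_H eps_H tau_H -> is_bimonad m_R e_R d_R eps_R tau_R) /\
  (yang_baxter tau_H <-> yang_baxter tau_R).
Proof.
  intros _ _ -> -> -> -> ->; split.
  - apply (conjugate_is_bimonad (adj := adj)); apply conjugate_mate.
  - apply (conjugate_yang_baxter (adj := adj)), conjugate_mate.
Qed.
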